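(* Let $\Omega_1\subset\mathbb{R}^{d_1}$, $\Omega_2\subset\mathbb{R}^{d_2}$ be compact domains, $\Omega=\Omega_1\times\Omega_2$, $\gamma>0$, let $c\in L^2(\Omega)$ with $c\ge\underline{c}$ a.e. for some constant $\underline{c}>-\infty$, and let $\mu_i\in L^2(\Omega_i)$ with $\mu_i\ge\delta$ a.e. for some constant $\delta>0$ and $\int_{\Omega_i}\mu_i\,\mathrm{d}\lambda_i=1$, $i=1,2$. Then every solution $(\alpha_1^*,\alpha_2^* )\in L^1(\Omega_1)\times L^1(\Omega_2)$ of the auxiliary dual problem (D') satisfies $\alpha_i^*\in L^2(\Omega_i)$, $i=1,2$, and is therefore also a solution of the dual problem (D). Moreover, the negative parts of $\alpha_1^*$ and $\alpha_2^*$ are (essentially) bounded, and the function $\frac1\gamma(\alpha_1^*\oplus\alpha_2^*-c)_+$ has the marginals $\mu_1$ and $\mu_2$, i.e. $$\int_{\Omega_2}\tfrac1\gamma(\alpha_1^*\oplus\alpha_2^*-c)_+\,\mathrm{d}\lambda_2=\mu_1\ \ \lambda_1\text{-a.e. in }\Omega_1,\qquad \int_{\Omega_1}\tfrac1\gamma(\alpha_1^*\oplus\alpha_2^*-c)_+\,\mathrm{d}\lambda_1=\mu_2\ \ \lambda_2\text{-a.e. in }\Omega_2.$$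
   Context: $\lambda_1,\lambda_2,\lambda$ denote Lebesgue measure on $\Omega_1,\Omega_2,\Omega$. A compact domain is understood as a compact set of positive Lebesgue measure. $x_+=\max(x,0)$, $x_-=\max(-x,0)$. For functions $v_i$ on $\Omega_i$, $(v_1\oplus v_2)(x_1,x_2)=v_1(x_1)+v_2(x_2)$. Define $$\Phi(\alpha_1,\alpha_2)=\tfrac12\|(\alpha_1\oplus\alpha_2-c)_+\|_{L^2(\Omega)}^2-\gamma\int_{\Omega_1}\alpha_1\mu_1\,\mathrm{d}\lambda_1-\gamma\int_{\Omega_2}\alpha_2\mu_2\,\mathrm{d}\lambda_2 .$$ Problem (D): minimize $\Phi(\alpha_1,\alpha_2)$ over $\alpha_i\in L^2(\Omega_i)$, $i=1,2$. Problem (D'): minimize $\Phi(\alpha_1,\alpha_2)$ over $\alpha_i\in L^1(\Omega_i)$, $i=1,2$, with $(\alpha_1\oplus\alpha_2-c)_+\in L^2(\Omega)$. On the feasible set of (D'), each integral $\int\alpha_i\mu_i\,\mathrm{d}\lambda_i$ is a well-defined element of $[-\infty,\infty)$ (the positive part of $\alpha_i$ is in $L^2$ there; the integral is $-\infty$ if $(\alpha_i)_-\mu_i$ is not integrable), so $\Phi$ takes values in $(-\infty,+\infty]$. *)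

(* Defs.v *)
From HB Require Import structures.
From mathcomp Require Import all_boot all_order all_algebra.
From mathcomp Require Import all_classical all_reals all_analysis.
From mathcomp Require Import measurable_realfun.

Set Implicit Arguments.
Unset Strict Implicit.
Unset Printing Implicit Defensive.

Import Order.TTheory GRing.Theory Num.Theory.
Import numFieldNormedType.Exports.

Local Open Scope classical_set_scope.
Local Open Scope ring_scope.

(* The space R^n is 'rV[R]_n, with the library's topology. It is given the
   sigma-algebra generated by the coordinates, as the library does for
   n.-tuple T. *)
Section measurable_rV.
Context {R : realType} (n : nat).

Let coors : 'I_n -> 'rV[R]_n -> measurableTypeR R := fun i x => x ord0 i.

Let rV_set0 : g_sigma_preimage coors set0.
Proof. exact: sigma_algebra0. Qed.

Let rV_setC A : g_sigma_preimage coors A -> g_sigma_preimage coors (~` A).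
Proof. exact: sigma_algebraC. Qed.

Let rV_bigcup (F : (set 'rV[R]_n)^nat) :
  (forall i, g_sigma_preimage coors (F i)) ->
  g_sigma_preimage coors (\bigcup_i (F i)).
Proof. exact: sigma_algebra_bigcup. Qed.

HB.instance Definition _ := @isMeasurable.Build default_measure_display
  'rV[R]_n (g_sigma_preimage coors) rV_set0 rV_setC rV_bigcup.

Lemma measurable_coor (i : 'I_n) :
  measurable_fun [set: 'rV[R]_n] (fun x : 'rV[R]_n => x ord0 i).
Proof.
move=> _ Y mY; rewrite setTI; apply: sub_sigma_algebra => /=.
rewrite -bigcup_seq/=; exists i => /=; first by rewrite mem_index_enum.
by exists Y => //; rewrite setTI.
Qed.

Lemma measurable_fun_rV d (T : measurableType d) (f : T -> 'rV[R]_n) :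
  (forall i, measurable_fun [set: T] (fun t => f t ord0 i)) ->
  measurable_fun [set: T] f.
Proof.
move=> mf.
suff H : g_sigma_preimage (fun i => coors i \o f) `<=` measurable.
  move=> _ A mA; apply: H; rewrite g_sigma_preimage_comp.
  by exists A.
apply: smallest_sub; first exact: sigma_algebra_measurable.
move=> A; rewrite -bigcup_seq/= => -[i _ [B mB <-]].
exact: mf.
Qed.

(* This sigma-algebra is the Borel sigma-algebra. *)
Lemma measurable_rVE :
  measurable = <<s [set A : set 'rV[R]_n | open A] >> :> set (set 'rV[R]_n).
Proof.
rewrite eqEsubset; split; apply: smallest_sub.
- exact: smallest_sigma_algebra.
- move=> A; rewrite -bigcup_seq/= => -[i _ [B mB <-]]; rewrite setTI.
  pose G := [set B : set R |
    <<s [set A : set 'rV[R]_n | open A] >> (coors i @^-1` B)].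
  have sG : sigma_algebra setT G.
    split; rewrite /G /=.
    - by rewrite preimage_set0; exact: sigma_algebra0.
    - by move=> X GX; rewrite setTD preimage_setC; exact: sigma_algebraC.
    - by move=> F GF; rewrite preimage_bigcup; exact: sigma_algebra_bigcup.
  move: mB; rewrite RGenOpens.measurableE.
  suff : <<s @RGenOpens.G R >> `<=` G by exact.
  apply: smallest_sub; first exact: sG.
  move=> _ [a [b ->]]; apply: sub_sigma_algebra => /=.
  by apply: open_comp (@interval_open _ _ _ _ _) => // x _; exact: coord_continuous.
- exact: sigma_algebra_measurable.
- move=> A oA.
  pose D := [set qk : 'rV[rat]_n * nat |
    ball (map_mx ratr qk.1 : 'rV[R]_n) qk.2.+1%:R^-1 `<=` A].
  have -> : A = \bigcup_(qk in D)
      ball (map_mx ratr qk.1 : 'rV[R]_n) qk.2.+1%:R^-1.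
    rewrite eqEsubset; split=> [x Ax|x [qk Dqk]]; last exact: Dqk.
    have /nbhs_ballP[e /= e0 xeA] : nbhs x A by exact: open_nbhs_nbhs.
    have /ltr_add_invr[k] : 0 < e / 2 by rewrite divr_gt0.
    rewrite add0r => ke.
    have k0 : (0 : R) < k.+1%:R^-1 by rewrite invr_gt0.
    have /choice[q qx] : forall i, exists q : rat,
        `|(ratr q : R) - x ord0 i| < k.+1%:R^-1.
      move=> i.
      have /rat_in_itvoo[q] : x ord0 i - k.+1%:R^-1 < x ord0 i + k.+1%:R^-1.
        by rewrite ltrD2l gtrN.
      by rewrite in_itv/= => qx; exists q; rewrite ltr_distl.
    have xq : ball (map_mx ratr (\row_i q i) : 'rV[R]_n) k.+1%:R^-1 x.
      by split=> // i j; rewrite !mxE ord1; exact: qx.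
    exists (\row_i q i, k) => //= y yq.
    apply: xeA; rewrite [e]splitr.
    apply: (@ball_triangle _ _ (map_mx ratr (\row_i q i) : 'rV[R]_n)).
      by apply: (le_ball (ltW ke)); exact: ball_sym.
    exact: (le_ball (ltW ke)).
  rewrite bigcup_mkcond.
  apply: countable_bigcupT_measurable => // qk.
  case: ifPn => // _.
  have -> : ball (map_mx ratr qk.1 : 'rV[R]_n) qk.2.+1%:R^-1 =
    \bigcap_(i in [set: 'I_n])
      (coors i @^-1` ball (ratr (qk.1 ord0 i) : R) qk.2.+1%:R^-1).
    rewrite eqEsubset; split => x /=.
      by move=> [_ xq] i _ /=; have := xq ord0 i; rewrite mxE.
    by move=> xq; split=> // i j; rewrite mxE ord1; exact: xq.
  apply: fin_bigcap_measurable => // i _; rewrite -[X in measurable X]setTI.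
  by apply: measurable_coor => //; exact: measurable_ball.
Qed.

End measurable_rV.

Section lebesgue_rV.
Context {R : realType}.
Local Open Scope ereal_scope.

Definition rV_cons n (p : measurableTypeR R * 'rV[R]_n) : 'rV[R]_n.+1 :=
  row_mx (p.1)%:M p.2.

Definition rV_uncons n (x : 'rV[R]_n.+1) : measurableTypeR R * 'rV[R]_n :=
  (x ord0 ord0, \row_i x ord0 (lift ord0 i)).

Lemma rV_cons0 n (p : R * 'rV[R]_n) : rV_cons p ord0 ord0 = p.1.
Proof.
rewrite /rV_cons.
have -> : ord0 = lshift n (ord0 : 'I_1) :> 'I_(1 + n) by apply: val_inj.
by rewrite (row_mxEl (p.1)%:M) mxE eqxx mulr1n.
Qed.

Lemma rV_consS n (p : R * 'rV[R]_n) (i : 'I_n) :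
  rV_cons p ord0 (lift ord0 i) = p.2 ord0 i.
Proof.
rewrite /rV_cons.
have -> : lift ord0 i = rshift 1 i :> 'I_(1 + n) by apply: val_inj.
by rewrite (row_mxEr (p.1)%:M).
Qed.

Lemma rV_consK n : cancel (@rV_cons n) (@rV_uncons n).
Proof.
move=> [a v]; congr pair; first exact: rV_cons0.
by apply/rowP => i; rewrite mxE rV_consS.
Qed.

Lemma rV_unconsK n : cancel (@rV_uncons n) (@rV_cons n).
Proof.
move=> x; apply/rowP => i; case: (unliftP ord0 i) => [j|] ->.
  by rewrite rV_consS mxE.
by rewrite rV_cons0.
Qed.

Lemma measurable_rV_cons n : measurable_fun setT (@rV_cons n).
Proof.
apply: measurable_fun_rV => i; case: (unliftP ord0 i) => [j|] ->.
  under eq_fun do rewrite rV_consS.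
  exact: (measurableT_comp (measurable_coor j) measurable_snd).
under eq_fun do rewrite rV_cons0.
exact: measurable_fst.
Qed.

Lemma measurable_rV_uncons n : measurable_fun setT (@rV_uncons n).
Proof.
apply: measurable_fun_pair => /=; first exact: measurable_coor.
apply: measurable_fun_rV => i.
under eq_fun do rewrite mxE.
exact: measurable_coor.
Qed.

HB.instance Definition _ n := isMeasurableFun.Build _ _ _ _ (@rV_cons n)
  (@measurable_rV_cons n).

Section step.
Context n (m : {sigma_finite_measure set 'rV[R]_n -> \bar R}).

Definition lebesgueS : set 'rV[R]_n.+1 -> \bar R :=
  pushforward (@lebesgue_measure R \x m) (@rV_cons n).

Let lebesgueS0 : lebesgueS set0 = 0. Proof. exact: measure0. Qed.

Let lebesgueS_ge0 A : 0 <= lebesgueS A. Proof. exact: measure_ge0. Qed.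

Let lebesgueS_sigma_additive : semi_sigma_additive lebesgueS.
Proof. exact: measure_semi_sigma_additive. Qed.

HB.instance Definition _ := isMeasure.Build _ _ _ lebesgueS
  lebesgueS0 lebesgueS_ge0 lebesgueS_sigma_additive.

Let lebesgueS_sigma_finite : sigma_finite setT lebesgueS.
Proof.
have /sigma_finiteP[F [TF ndF Foo]] := sigma_finiteT (@lebesgue_measure R).
have /sigma_finiteP[G [TG ndG Goo]] := sigma_finiteT m.
exists (fun k => @rV_uncons n @^-1` (F k `*` G k)).
  apply/seteqP; split=> // x _.
  have [i _ Fi] : (\bigcup_i F i) (rV_uncons x).1 by rewrite -TF.
  have [j _ Gj] : (\bigcup_i G i) (rV_uncons x).2 by rewrite -TG.
  exists (maxn i j) => //; split.
  - by move: Fi; exact/subsetPset/ndF/leq_maxl.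
  - by move: Gj; exact/subsetPset/ndG/leq_maxr.
move=> k; have [mF Fk] := Foo k; have [mG Gk] := Goo k; split.
  rewrite -[X in measurable X]setTI.
  by apply: measurable_rV_uncons => //; exact: measurableX.
rewrite /lebesgueS /pushforward -comp_preimage.
rewrite (_ : _ \o _ = id); last by rewrite funeqE => x /=; rewrite rV_consK.
by rewrite preimage_id product_measure1E// lte_mul_pinfty// ge0_fin_numE.
Qed.

HB.instance Definition _ := Measure_isSigmaFinite.Build _ _ _ lebesgueS
  lebesgueS_sigma_finite.

End step.

Fixpoint lebesgue_rV n : {sigma_finite_measure set 'rV[R]_n -> \bar R} :=
  match n with
  | 0 => [the {sigma_finite_measure set _ -> \bar R} of \d_ (0%R : 'rV[R]_0)]
  | k.+1 => [the {sigma_finite_measure set _ -> \bar R} of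
              lebesgueS (lebesgue_rV k)]
  end.

End lebesgue_rV.

Lemma lebesgue_rV_box (R : realType) n (B : 'I_n -> set R) :
  (forall i, measurable (B i)) ->
  lebesgue_rV n [set x : 'rV[R]_n | forall i, B i (x ord0 i)] =
  (\prod_(i < n) lebesgue_measure (B i))%E.
Proof.
elim: n B => [|n IH] B mB /=.
  by rewrite big_ord0 diracE mem_set//= => -[].
rewrite /lebesgueS /pushforward big_ord_recl.
rewrite -IH// -product_measure1E//; last first.
  have -> : [set x : 'rV[R]_n | forall i, B (lift ord0 i) (x ord0 i)] =
      \bigcap_(i in [set: 'I_n])
        ((fun x : 'rV[R]_n => x ord0 i) @^-1` B (lift ord0 i)).
    by apply/seteqP; split => x /= Bx i; [move=> _|]; exact: Bx.
  apply: fin_bigcap_measurable => // i _.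
  rewrite -[X in measurable X]setTI.
  by apply: measurable_coor.
  exact: mB.
apply: (congr1 (product_measure1 _ _)); apply/seteqP; split=> -[a v] /=.
  move=> Bx; split; first by have := Bx ord0; rewrite rV_cons0.
  by move=> i; have := Bx (lift ord0 i); rewrite rV_consS.
move=> [Ba Bv] i; case: (unliftP ord0 i) => [j|] ->.
  by rewrite rV_consS; exact: Bv.
by rewrite rV_cons0.
Qed.

Section Lp_on.
Context d (T : measurableType d) (R : realType).
Variable mu : {measure set T -> \bar R}.

(* f \_ D is the extension of f by 0 outside of D, so that only the values of
   f on D matter. *)
Definition Lp_on (p : \bar R) (D : set T) (f : T -> R) : Prop :=
  (f \_ D) \in Lfun mu p.

Definition Lp_norm_on (p : \bar R) (D : set T) (f : T -> R) : \bar R :=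
  ('N[mu]_p[EFin \o (f \_ D)])%E.

End Lp_on.

Definition oplus (R : realType) (T1 T2 : Type) (v1 : T1 -> R) (v2 : T2 -> R) :
  T1 * T2 -> R := fun x => v1 x.1 + v2 x.2.

Definition is_minimizer (R : realType) (X : Type) (F : X -> \bar R)
    (feasible : set X) (x : X) : Prop :=
  feasible x /\ forall y, feasible y -> (F x <= F y)%E.

Section dual_problems.
Context {R : realType} {d1 d2 : measure_display}.
Context {T1 : measurableType d1} {T2 : measurableType d2}.
Variable la1 : {sigma_finite_measure set T1 -> \bar R}.
Variable la2 : {sigma_finite_measure set T2 -> \bar R}.
Variables (Om1 : set T1) (Om2 : set T2).
Variables (gamma : R) (c : T1 * T2 -> R) (mu1 : T1 -> R) (mu2 : T2 -> R).
Implicit Type alpha : (T1 -> R) * (T2 -> R).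

Definition excess alpha : T1 * T2 -> R :=
  (oplus alpha.1 alpha.2 \- c)^\+.

(* The integrals are extended-real valued: each is -oo when the negative part
   of the integrand has infinite integral and the positive part a finite one. *)
Definition Phi alpha : \bar R :=
  ((2^-1)%:E * Lp_norm_on (la1 \x la2) 2%:E (Om1 `*` Om2) (excess alpha) ^+ 2
   - gamma%:E * \int[la1]_(x in Om1) (alpha.1 x * mu1 x)%:E
   - gamma%:E * \int[la2]_(x in Om2) (alpha.2 x * mu2 x)%:E)%E.

Definition feasible_D : set ((T1 -> R) * (T2 -> R)) :=
  [set alpha | Lp_on la1 2%:E Om1 alpha.1 /\ Lp_on la2 2%:E Om2 alpha.2].

Definition feasible_D' : set ((T1 -> R) * (T2 -> R)) :=
  [set alpha | [/\ Lp_on la1 1%:E Om1 alpha.1, Lp_on la2 1%:E Om2 alpha.2 &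
    Lp_on (la1 \x la2)%E 2%:E (Om1 `*` Om2) (excess alpha)]].

Definition solves_D alpha := is_minimizer Phi feasible_D alpha.

Definition solves_D' alpha := is_minimizer Phi feasible_D' alpha.

End dual_problems.

(* Main.v *)
(* Perturbing a solution [(a1, a2)] of (D') by [t * 1_A] in the first argument
   and using [(w + s)_+ ^ 2 <= w_+ ^ 2 + 2 s w_+ + s ^ 2], minimality forces the
   coefficient of [t] to vanish: the integral of [e = (a1 (+) a2 - c)_+] over
   [A x Om2] is [gamma] times that of [mu1] over [A]. With [A] arbitrary this
   is the marginal condition. With [A = {a1 <= - r}] it bounds
   [gamma delta |A|] by [|A|] times the integral of [(a2 - c_low - r)_+], which
   tends to [0] as [r] grows, so [a1] is essentially bounded below. The positive
   part of [a1] is square integrable because [a1 <= e + r + |c|] on [Om1 x A2]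
   for some [A2] of positive measure on which [a2 >= - r]; before the variation
   is taken, this also guarantees that [Phi] is finite at the solution. The
   second coordinate follows by exchanging the two factors. *)
Require Import Defs.
From HB Require Import structures.
From mathcomp Require Import all_boot all_order all_algebra.
From mathcomp Require Import all_classical all_reals all_analysis.
From mathcomp Require Import measurable_realfun ess_sup_inf ring lra.
Import Order.TTheory GRing.Theory Num.Theory.
Import numFieldNormedType.Exports.
Set Implicit Arguments.
Unset Strict Implicit.
Unset Printing Implicit Defensive.
Local Open Scope classical_set_scope.
Local Open Scope ring_scope.

(** * Square-integrable, integrable and essentially bounded functions on a set *)

Lemma poweR_sqr (R : realType) (x : \bar R) :
  (0 <= x)%E -> (x `^ 2 = x ^+ 2)%E.
Proof.
case: x => [r r0|_|//]; last by rewrite poweRyr ?pnatr_eq0// expe2 mulyy.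
by rewrite poweR_EFin powR_mulrn.
Qed.

Section Lp_on_theory.
Context d (T : measurableType d) (R : realType).
Variables (mu : {measure set T -> \bar R}) (D : set T).
Hypothesis mD : measurable D.
Implicit Types f g : T -> R.

Lemma measurable_patch f :
  measurable_fun [set: T] (f \_ D) <-> measurable_fun D f.
Proof. by rewrite -measurable_restrictT. Qed.

Lemma Lp_on1P f : Lp_on mu 1%:E D f <-> mu.-integrable D (EFin \o f).
Proof.
rewrite /Lp_on Lfun1_integrable -restrict_EFin.
by rewrite -(integrable_mkcond _ mD).
Qed.

(** The identity lives in the extended reals, where both sides may be [+oo]; it turns the penalty in
    [Phi] into an integral. *)
Lemma Lp_norm_on2E f :
  (Lp_norm_on mu 2%:E D f ^+ 2 = \int[mu]_(x in D) (f x ^+ 2)%:E)%E.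
Proof.
rewrite -poweR_sqr; last exact: Lnorm_ge0.
rewrite /Lp_norm_on poweR_Lnorm// [RHS]integral_mkcond.
apply: eq_integral => x _ /=; rewrite !patchE; case: ifPn => _ /=.
  by rewrite powR_mulrn// real_normK// num_real.
by rewrite normr0 powR0.
Qed.

Lemma Lp_on2P f : Lp_on mu 2%:E D f <->
  measurable_fun D f /\ mu.-integrable D (fun x => (f x ^+ 2)%:E).
Proof.
rewrite /Lp_on; split.
  move=> fL; have mf : measurable_fun D f.
    by apply/measurable_patch; move/andP: fL => [/[!inE]].
  split=> //; apply/integrableP; split.
    by apply/measurable_EFinP; exact: measurable_funX.
  under eq_integral do rewrite gee0_abs ?lee_fin ?sqr_ge0//.
  rewrite -Lp_norm_on2E -poweR_sqr ?Lnorm_ge0//.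
  by apply: poweR_lty; move/andP: fL => [_ /[!inE]].
move=> [mf /integrableP[_]].
under eq_integral do rewrite gee0_abs ?lee_fin ?sqr_ge0//.
rewrite -Lp_norm_on2E -poweR_sqr ?Lnorm_ge0// => foo.
apply/andP; split; rewrite inE/=; first exact/measurable_patch.
by apply: lty_poweRy foo; rewrite pnatr_eq0.
Qed.

Lemma le_Lp_on2 f g : measurable_fun D f ->
  {ae mu, forall x, D x -> `|f x| <= `|g x|} ->
  Lp_on mu 2%:E D g -> Lp_on mu 2%:E D f.
Proof.
move=> mf fg /Lp_on2P[mg /integrableP[mg2 g2]]; apply/Lp_on2P; split=> //.
have mf2 : measurable_fun D (fun x => (f x ^+ 2)%:E).
  by apply/measurable_EFinP; exact: measurable_funX.
apply/integrableP; split=> //; apply: le_lt_trans g2.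
apply: ae_ge0_le_integral => //.
- exact: measurableT_comp.
- exact: measurableT_comp.
- apply: filterS fg => x fg Dx; rewrite lee_fin !normrX.
  by rewrite ler_sqr ?nnegrE//; exact: fg.
Qed.

Lemma Lp_on2D f g : Lp_on mu 2%:E D f -> Lp_on mu 2%:E D g ->
  Lp_on mu 2%:E D (fun x => f x + g x).
Proof.
rewrite /Lp_on => fL gL.
have -> : (fun x => f x + g x) \_ D = (f \_ D) + (g \_ D).
  by apply/funext => x /=; rewrite /GRing.add/= !patchE; case: ifPn; rewrite ?addr0.
by apply: rpredD; rewrite ?lee1n.
Qed.

Lemma Lp_on2_norm f : Lp_on mu 2%:E D f -> Lp_on mu 2%:E D (fun x => `|f x|).
Proof.
move=> fL; have /Lp_on2P[mf _] := fL; apply: le_Lp_on2 fL.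
  exact: measurableT_comp.
by apply: aeW => x _; rewrite normr_id.
Qed.

Lemma Lp_on2_cst r : (mu D < +oo)%E -> Lp_on mu 2%:E D (cst r).
Proof.
move=> muD; apply/Lp_on2P; split=> //.
apply/integrableP; split; first exact: (measurable_cst (r ^+ 2)%:E).
under eq_integral do rewrite gee0_abs ?lee_fin ?sqr_ge0//.
by rewrite (integral_cst _ mD (r ^+ 2)%:E) lte_mul_pinfty// lee_fin sqr_ge0.
Qed.

Lemma Lp_on2_bounded f r : (mu D < +oo)%E -> measurable_fun D f ->
  {ae mu, forall x, D x -> `|f x| <= r} -> Lp_on mu 2%:E D f.
Proof.
move=> muD mf fr; apply: le_Lp_on2 (Lp_on2_cst r muD) => //.
by apply: filterS fr => x fr Dx /=; rewrite (le_trans (fr Dx))// ler_norm.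
Qed.

(** Hölder's inequality with both exponents 2, applied to the extensions by zero. *)
Lemma Lp_on2_mul f g : Lp_on mu 2%:E D f -> Lp_on mu 2%:E D g ->
  mu.-integrable D (fun x => (f x * g x)%:E).
Proof.
move=> fL gL; have := Lfun2_mul_Lfun1 fL gL.
suff -> : (f \_ D) \* (g \_ D) = (fun x => f x * g x) \_ D by move/Lp_on1P.
by apply/funext => x /=; rewrite !patchE; case: ifPn; rewrite ?mulr0.
Qed.

(** Multiply by the constant [1], which is square integrable on a set of finite measure. *)
Lemma Lp_on2_integrable f : (mu D < +oo)%E -> Lp_on mu 2%:E D f ->
  mu.-integrable D (EFin \o f).
Proof.
move=> muD fL; have := Lp_on2_mul fL (Lp_on2_cst 1 muD).
by under eq_fun do rewrite mulr1.
Qed.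

Lemma Lp_ony_bounded f r : measurable_fun D f ->
  {ae mu, forall x, D x -> `|f x| <= r} -> Lp_on mu +oo%E D f.
Proof.
move=> mf fr; apply/andP; split; rewrite inE/=; first exact/measurable_patch.
rewrite /finite_norm unlock; case: ifPn => // _.
(* The bound is [Num.max 0 r] because the extension takes the value 0 outside [D], where a negative
   [r] would fail. *)
apply: (@le_lt_trans _ _ (Num.max 0 r)%:E); last exact: ltry.
apply/ess_supP; apply: filterS fr => x fr; rewrite /= lee_fin patchE.
case: ifPn => [/set_mem/fr fxr|_]; first by rewrite le_max fxr orbT.
by rewrite normr0 le_max lexx.
Qed.

End Lp_on_theory.

Lemma Lp_on2_subset d (T : measurableType d) (R : realType)
    (mu : {measure set T -> \bar R}) (D E : set T) (f : T -> R) :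
  measurable D -> measurable E -> E `<=` D ->
  Lp_on mu 2%:E D f -> Lp_on mu 2%:E E f.
Proof.
move=> mD mE ED /(Lp_on2P mu mD)[mf f2]; apply/(Lp_on2P mu mE); split.
  exact: measurable_funS mf.
exact: integrableS f2.
Qed.

(** * Tonelli on rectangles, and functions of one coordinate *)

Section product.
Context {R : realType} {d1 d2 : measure_display}.
Context {T1 : measurableType d1} {T2 : measurableType d2}.
Variable la1 : {sigma_finite_measure set T1 -> \bar R}.
Variable la2 : {sigma_finite_measure set T2 -> \bar R}.

(** Tonelli on the whole product, applied to the extension of [f] by zero: its partial integral is
    the extension by zero of the partial integral over [A2]. *)
Lemma tonelli_setX (A1 : set T1) (A2 : set T2) (f : T1 * T2 -> \bar R) :
  measurable A1 -> measurable A2 -> measurable_fun (A1 `*` A2) f ->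
  (forall x, (A1 `*` A2) x -> 0 <= f x)%E ->
  measurable_fun A1 (fun x => \int[la2]_(y in A2) f (x, y))%E /\
  (\int[la1 \x la2]_(z in A1 `*` A2) f z =
   \int[la1]_(x in A1) \int[la2]_(y in A2) f (x, y))%E.
Proof.
move=> mA1 mA2 mf f0.
have mA : measurable (A1 `*` A2) by exact: measurableX.
have mF : measurable_fun [set: T1 * T2] (f \_ (A1 `*` A2)).
  exact/(measurable_restrictT _ mA).
have F0 z : (0 <= (f \_ (A1 `*` A2)) z)%E.
  by rewrite patchE; case: ifPn => // /set_mem/f0.
have FE : fubini_F la2 (f \_ (A1 `*` A2)) =
    (fun x => \int[la2]_(y in A2) f (x, y))%E \_ A1.
  apply/funext => x; rewrite /fubini_F !patchE; case: ifPn => xA1.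
    rewrite [RHS]integral_mkcond; apply: eq_integral => y _.
    by rewrite !patchE in_setX/= xA1.
  by apply: integral0_eq => y _; rewrite patchE in_setX/= (negbTE xA1).
split.
  apply/(measurable_restrictT _ mA1); rewrite -FE.
  exact: measurable_fun_fubini_tonelli_F.
by rewrite integral_mkcond fubini_tonelli1// FE [RHS]integral_mkcond.
Qed.

Lemma measurable_fun_fst (A1 : set T1) (A2 : set T2) (f : T1 -> R) :
  measurable A1 -> measurable A2 -> measurable_fun A1 f ->
  measurable_fun (A1 `*` A2) (f \o fst).
Proof.
move=> mA1 mA2 mf; apply: (measurable_comp mA1) => //.
  by move=> _ [z [z1 _] <-].
exact: measurable_funTS measurable_fst.
Qed.

Lemma measurable_fun_snd (A1 : set T1) (A2 : set T2) (f : T2 -> R) :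
  measurable A1 -> measurable A2 -> measurable_fun A2 f ->
  measurable_fun (A1 `*` A2) (f \o snd).
Proof.
move=> mA1 mA2 mf; apply: (measurable_comp mA2) => //.
  by move=> _ [z [_ z2] <-].
exact: measurable_funTS measurable_snd.
Qed.

(** By Tonelli the integral of the square over the rectangle is that over [A1] times [la2 A2]. Since
    this factor is positive, an infinite integral over [A1] would make the product infinite. *)
Lemma Lp_on2_fst_inv (A1 : set T1) (A2 : set T2) (f : T1 -> R) :
  measurable A1 -> measurable A2 -> (0 < la2 A2)%E -> measurable_fun A1 f ->
  Lp_on (la1 \x la2)%E 2%:E (A1 `*` A2) (f \o fst) -> Lp_on la1 2%:E A1 f.
Proof.
move=> mA1 mA2 A20 mf.
have mA : measurable (A1 `*` A2) by exact: measurableX.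
move=> /(Lp_on2P _ mA)[_ /integrableP[mff +]].
under eq_integral do rewrite gee0_abs ?lee_fin ?sqr_ge0//.
have [_ ->] := tonelli_setX mA1 mA2 mff (fun x _ => sqr_ge0 _).
under eq_integral do rewrite /= integral_cst//.
have mf2 : measurable_fun A1 (fun x => (f x ^+ 2)%:E).
  by apply/measurable_EFinP; exact: measurable_funX.
rewrite ge0_integralZr//; last by move=> x _; rewrite lee_fin sqr_ge0.
move=> foo; apply/(Lp_on2P _ mA1); split=> //; apply/integrableP; split=> //.
under eq_integral do rewrite gee0_abs ?lee_fin ?sqr_ge0//.
rewrite ltNge leye_eq; apply/eqP => fy.
by move: foo; rewrite fy gt0_mulye// ltxx.
Qed.

Lemma Lp_on2_fst (A1 : set T1) (A2 : set T2) (f : T1 -> R) :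
  measurable A1 -> measurable A2 -> (la2 A2 < +oo)%E ->
  Lp_on la1 2%:E A1 f ->
  Lp_on (la1 \x la2)%E 2%:E (A1 `*` A2) (f \o fst).
Proof.
move=> mA1 mA2 A2oo /(Lp_on2P _ mA1)[mf /integrableP[mf2]].
have mA : measurable (A1 `*` A2) by exact: measurableX.
under eq_integral do rewrite gee0_abs ?lee_fin ?sqr_ge0//.
move=> foo; apply/(Lp_on2P _ mA); split; first exact: measurable_fun_fst.
have mff : measurable_fun (A1 `*` A2) (fun x => ((f \o fst) x ^+ 2)%:E).
  by apply/measurable_EFinP/measurable_funX; exact: measurable_fun_fst.
apply/integrableP; split=> //.
under eq_integral do rewrite gee0_abs ?lee_fin ?sqr_ge0//.
have [_ ->] := tonelli_setX mA1 mA2 mff (fun x _ => sqr_ge0 _).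
under eq_integral do rewrite /= integral_cst//.
rewrite ge0_integralZr//; last by move=> x _; rewrite lee_fin sqr_ge0.
rewrite lte_mul_pinfty//; first by apply: integral_ge0 => x _; rewrite lee_fin sqr_ge0.
by rewrite ge0_fin_numE// integral_ge0// => x _; rewrite lee_fin sqr_ge0.
Qed.

End product.

(** * Exchange of the two factors of a product *)

Section swap.
Context {R : realType} {d1 d2 : measure_display}.
Context {T1 : measurableType d1} {T2 : measurableType d2}.
Variable la1 : {sigma_finite_measure set T1 -> \bar R}.
Variable la2 : {sigma_finite_measure set T2 -> \bar R}.

Lemma preimage_swapX (A1 : set T1) (A2 : set T2) :
  swap_pair @^-1` (A1 `*` A2) = A2 `*` A1.
Proof. by apply/seteqP; split => -[x y] []. Qed.

(** The pushforward of [la2 \x la1] under the swap agrees with [la1 \x la2] on rectangles, so the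
    uniqueness of the product measure applies. *)
Lemma product_measure_swap (A : set (T1 * T2)) : measurable A ->
  (la2 \x la1)%E (swap_pair @^-1` A) = (la1 \x la2)%E A.
Proof.
move=> mA.
have mswap : measurable_fun [set: T2 * T1] (@swap_pair T2 T1) by exact: measurable_swap.
pose phi : {mfun (T2 * T1)%type >-> (T1 * T2)%type} := mfun_Sub (mem_set mswap).
rewrite -[LHS]/(pushforward (la2 \x la1)%E phi A).
apply/esym/product_measure_unique => // B1 B2 mB1 mB2.
rewrite -[LHS]/((la2 \x la1)%E (swap_pair @^-1` (B1 `*` B2))) preimage_swapX.
by rewrite /= product_measure1E// muleC.
Qed.

Lemma integral_swap (A1 : set T1) (A2 : set T2) (f : T1 * T2 -> \bar R) :
  measurable A1 -> measurable A2 -> measurable_fun (A1 `*` A2) f ->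
  (forall x, (A1 `*` A2) x -> 0 <= f x)%E ->
  (\int[la1 \x la2]_(z in A1 `*` A2) f z =
   \int[la2 \x la1]_(z in A2 `*` A1) f (swap_pair z))%E.
Proof.
move=> mA1 mA2 mf f0.
have mA : measurable (A1 `*` A2) by exact: measurableX.
have mswap : measurable_fun [set: T2 * T1] (@swap_pair T2 T1) by exact: measurable_swap.
pose phi : {mfun (T2 * T1)%type >-> (T1 * T2)%type} := mfun_Sub (mem_set mswap).
rewrite -preimage_swapX -[swap_pair]/(phi : _ -> _).
rewrite -ge0_integral_pushforward//; last by move=> x /set_mem/f0.
by apply: eq_measure_integral => A mmA _; exact/esym/product_measure_swap.
Qed.

Lemma ae_swap (P : T1 * T2 -> Prop) :
  {ae (la1 \x la2)%E, forall x, P x} -> {ae (la2 \x la1)%E, forall x, P (swap_pair x)}.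
Proof.
move=> [N [mN N0 PN]]; exists (swap_pair @^-1` N); split.
- by rewrite -[X in measurable X]setTI; exact: measurable_swap.
- by rewrite -N0; exact: product_measure_swap.
- by move=> x Px; exact: PN.
Qed.

Lemma Lp_on2_swap (A1 : set T1) (A2 : set T2) (f : T1 * T2 -> R) :
  measurable A1 -> measurable A2 ->
  Lp_on (la1 \x la2)%E 2%:E (A1 `*` A2) f ->
  Lp_on (la2 \x la1)%E 2%:E (A2 `*` A1) (f \o swap_pair).
Proof.
move=> mA1 mA2.
have mA : measurable (A1 `*` A2) by exact: measurableX.
have mA' : measurable (A2 `*` A1) by exact: measurableX.
move=> /(Lp_on2P _ mA)[mf /integrableP[mf2]].
under eq_integral do rewrite gee0_abs ?lee_fin ?sqr_ge0//.
rewrite integral_swap// => [foo|x _]; last by rewrite lee_fin sqr_ge0.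
have mfs : measurable_fun (A2 `*` A1) (f \o swap_pair).
  apply: (measurable_comp mA) => //; first by move=> _ [[x y] [? ?] <-].
  by apply: measurable_funTS; exact: measurable_swap.
apply/(Lp_on2P _ mA'); split=> //; apply/integrableP; split.
  by apply/measurable_EFinP; exact: measurable_funX.
by under eq_integral do rewrite gee0_abs ?lee_fin ?sqr_ge0//.
Qed.

End swap.

(** * A quadratic criterion, level sets, and finiteness of integrals *)

Lemma linear_coef_eq0 (R : realFieldType) (a k : R) :
  0 <= k -> (forall t, 0 <= t * a + t ^+ 2 * k) -> a = 0.
Proof.
move=> k0 H; apply/eqP; rewrite -sqrf_eq0; apply/eqP/le_anti.
rewrite sqr_ge0 andbT; have k1 : 0 < k + 1 by lra.
(* At this [t] the quadratic equals [- a ^+ 2 / (k + 1) ^+ 2]. Dividing by [k + 1] instead of [k]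
   covers [k = 0]. *)
have := H (- a / (k + 1)).
have -> : - a / (k + 1) * a + (- a / (k + 1)) ^+ 2 * k = - a ^+ 2 / (k + 1) ^+ 2.
  by field; rewrite gt_eqF.
by rewrite pmulr_lge0 ?invr_gt0 ?exprn_gt0// oppr_ge0.
Qed.

Section measure_lemmas.
Context d (T : measurableType d) (R : realType).
Variables (mu : {measure set T -> \bar R}) (D : set T).
Hypothesis mD : measurable D.

Lemma measurable_superlevel (f : T -> R) r : measurable_fun D f ->
  measurable (D `&` [set x | r <= f x]).
Proof.
move=> mf; have := mf mD `[r, +oo[%classic (measurable_itv _).
by congr measurable; apply/seteqP; split => x /=; rewrite in_itv/= andbT.
Qed.

(** [D] is the countable union of its parts where [f >= - n]; if all of them were null, so would be
    [D]. *)
Lemma exists_superlevel_gt0 (f : T -> R) : measurable_fun D f -> (0 < mu D)%E ->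
  exists r : R, (0 < mu (D `&` [set x | - r <= f x]%R))%E.
Proof.
move=> mf D0; apply: contrapT => /forallNP H; move: D0; rewrite ltNge => /negP; apply.
have -> : D = \bigcup_n (D `&` [set x | - (n%:R : R) <= f x]).
  apply/seteqP; split=> [x Dx|x [n _ []//]].
  exists (Num.truncn `|f x|).+1 => //; split=> //=; rewrite lerNl.
  by rewrite (le_trans (ler_norm _))// normrN ltW// truncnS_gt.
rewrite le_eqVlt; apply/orP; left; apply/eqP/negligibleP.
  by apply: bigcup_measurable => n _; exact: measurable_superlevel.
apply: negligible_bigcup => n; apply/negligibleP; first exact: measurable_superlevel.
by apply/eqP; rewrite eq_le measure_ge0 andbT leNgt; exact/negP/H.
Qed.

(** Dominated convergence along [r = n]: the integrand vanishes at [x] as soon as [n] exceeds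
    [|g x|], and [|g|] dominates. *)
Lemma integral_pos_part_shift_lt (g : T -> R) (e : R) : 0 < e ->
  mu.-integrable D (EFin \o g) ->
  exists r : R, (\int[mu]_(x in D) (Num.max (g x - r) 0)%:E < e%:E)%E.
Proof.
move=> e0 ig; have /integrableP[/measurable_EFinP mg _] := ig.
have mgn (r : R) : measurable_fun D (fun x => Num.max (g x - r) 0).
  by apply: measurable_maxr => //; exact: measurable_funB.
have [|||||_ _] := @dominated_convergence _ _ _ mu D mD
    (fun n x => (Num.max (g x - n%:R) 0)%:E) (cst 0%E)
    (fun x => `|(g x)%:E|%E).
- by move=> n; exact/measurable_EFinP.
- exact: measurable_cst.
- apply: aeW => x Dx; apply: cvg_near_cst; near=> n.
  congr EFin; apply/max_idPr; rewrite subr_le0.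
  rewrite (le_trans (ler_norm _))// ltW//; near: n.
  exact: nbhs_infty_gtr.
- exact: integrable_abse.
- apply: aeW => x n Dx; rewrite lee_fin ger0_norm ?le_max ?lexx ?orbT//.
  rewrite ge_max normr_ge0 andbT.
  by rewrite (le_trans _ (ler_norm _))// gerBl.
rewrite integral0 => /fine_cvgP[foo]/cvgr0Pnorm_lt/(_ _ e0) lte.
near \oo => n.
exists n%:R; rewrite -[ltLHS]fineK; last by near: n.
rewrite lte_fin (le_lt_trans (ler_norm _))//; near: n; exact: lte.
Unshelve. all: by end_near. Qed.

(** The integral is that of the positive part, which is finite, minus that of the negative part;
    were the latter infinite, the difference would be [-oo]. *)
Lemma integrable_of_integral_gtNy (f : T -> R) : measurable_fun D f ->
  mu.-integrable D (fun x => (Num.max (f x) 0)%:E) ->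
  (-oo < \int[mu]_(x in D) (f x)%:E)%E ->
  mu.-integrable D (EFin \o f).
Proof.
move=> mf ifp; rewrite integralE.
have mF : measurable_fun D (EFin \o f) by exact/measurable_EFinP.
have -> : ((fun x => (f x)%:E)^\+ = fun x => (Num.max (f x) 0)%:E)%E.
  by apply/funext => x; rewrite funeposE EFin_max.
have /fin_numPlt/andP[_ Pfin] := integrable_fin_num mD ifp.
move=> Noo; apply/integrableP; split=> //.
have -> : (\int[mu]_(x in D) `|(EFin \o f) x| =
    \int[mu]_(x in D) (Num.max (f x) 0)%:E +
    \int[mu]_(x in D) (fun x => (f x)%:E)^\- x)%E.
  rewrite -ge0_integralD//.
  - apply: eq_integral => x _.
    by rewrite -[LHS]/((abse \o (EFin \o f)) x) fune_abse funeposE EFin_max.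
  - by move=> x _; rewrite lee_fin le_max lexx orbT.
  - exact: measurable_int ifp.
  - exact: measurable_funeneg.
rewrite lte_add_pinfty// ltNge leye_eq; apply/eqP => Ny.
by move: Noo; rewrite Ny addeNy// ltxx.
Qed.

Lemma integral_lty_of_pos_part (f : T -> R) :
  mu.-integrable D (fun x => (Num.max (f x) 0)%:E) ->
  (\int[mu]_(x in D) (f x)%:E < +oo)%E.
Proof.
move=> ifp; rewrite integralE.
have -> : ((fun x => (f x)%:E)^\+ = fun x => (Num.max (f x) 0)%:E)%E.
  by apply/funext => x; rewrite funeposE EFin_max.
apply: le_lt_trans (integrable_lty mD ifp).
by rewrite geeDl// oppe_le0 integral_ge0.
Qed.

End measure_lemmas.

(** * The excess function, the feasible set and the functional *)

Section dual_problem_theory.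
Context {R : realType} {d1 d2 : measure_display}.
Context {T1 : measurableType d1} {T2 : measurableType d2}.
Variable la1 : {sigma_finite_measure set T1 -> \bar R}.
Variable la2 : {sigma_finite_measure set T2 -> \bar R}.
Variables (Om1 : set T1) (Om2 : set T2).
Hypothesis mOm1 : measurable Om1.
Hypothesis mOm2 : measurable Om2.
Variables (gamma : R) (c : T1 * T2 -> R) (mu1 : T1 -> R) (mu2 : T2 -> R).
Implicit Type alpha : (T1 -> R) * (T2 -> R).

Local Notation la := (la1 \x la2)%E.
Local Notation Om := (Om1 `*` Om2).
Local Notation feasible := (feasible_D' la1 la2 Om1 Om2 c).
Local Notation Phi := (Phi la1 la2 Om1 Om2 gamma c mu1 mu2).

Let mOm : measurable Om. Proof. exact: measurableX. Qed.

Lemma excess_ge0 alpha z : 0 <= excess c alpha z.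
Proof. exact: funrpos_ge0. Qed.

Lemma excess_ge alpha z : alpha.1 z.1 + alpha.2 z.2 - c z <= excess c alpha z.
Proof. by rewrite /excess /funrpos /= le_max lexx. Qed.

Lemma excess_le alpha z : excess c alpha z <= `|alpha.1 z.1| + `|alpha.2 z.2| + `|c z|.
Proof.
rewrite /excess /funrpos ge_max !addr_ge0// andbT.
by rewrite /oplus /= !lerD ?ler_norm// -normrN ler_norm.
Qed.

(** With [s = h z.1], the right side is [(w_+ + s) ^ 2]. If [w + s > 0] then [w + s <= w_+ + s] and
    squares preserve the order; otherwise the left side is 0. This replaces differentiation of the
    penalty by an explicit quadratic bound. *)
Lemma excess_shift_sqr alpha (h : T1 -> R) z :
  excess c (fun x => alpha.1 x + h x, alpha.2) z ^+ 2 <=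
  excess c alpha z ^+ 2 + 2 * (h z.1 * excess c alpha z) + h z.1 ^+ 2.
Proof.
rewrite /excess /funrpos /oplus /=.
set w := alpha.1 z.1 + _ - _.
rewrite [X in Num.max X _](_ : _ = w + h z.1); last by rewrite /w; ring.
by rewrite /Num.max; case: ifPn => ?; case: ifPn => ?; nra.
Qed.

(** The positive part is 1-Lipschitz; this keeps a perturbed pair feasible. *)
Lemma excess_shift_le alpha (h : T1 -> R) z :
  excess c (fun x => alpha.1 x + h x, alpha.2) z <= excess c alpha z + `|h z.1|.
Proof.
rewrite /excess /funrpos /oplus /=.
set w := alpha.1 z.1 + _ - _.
rewrite [X in Num.max X _](_ : _ = w + h z.1); last by rewrite /w; ring.
rewrite ge_max addr_ge0 ?andbT ?le_max ?lexx ?orbT//.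
by rewrite lerD ?ler_norm// le_max lexx.
Qed.

Lemma measurable_excess alpha :
  measurable_fun Om1 alpha.1 -> measurable_fun Om2 alpha.2 ->
  measurable_fun Om c -> measurable_fun Om (excess c alpha).
Proof.
move=> ma1 ma2 mc; apply: measurable_maxr => //; apply: measurable_funB => //.
apply: measurable_funD.
  exact: (@measurable_fun_fst _ _ _ _ _ Om1 Om2 alpha.1).
exact: (@measurable_fun_snd _ _ _ _ _ Om1 Om2 alpha.2).
Qed.

Lemma feasible_measurable alpha : feasible alpha ->
  [/\ measurable_fun Om1 alpha.1, measurable_fun Om2 alpha.2 &
      measurable_fun Om (excess c alpha)].
Proof.
move=> [/(Lp_on1P _ mOm1)/measurable_int m1 /(Lp_on1P _ mOm2)/measurable_int m2].
by move=> /(Lp_on2P _ mOm)[m3 _]; split=> //; exact/measurable_EFinP.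
Qed.

Section swap_problem.
Local Notation feasible' := (feasible_D' la2 la1 Om2 Om1 (c \o swap_pair)).

Lemma excess_swap a1 a2 :
  excess (c \o swap_pair) (a2, a1) = excess c (a1, a2) \o swap_pair.
Proof. by apply/funext => z; rewrite /excess /funrpos /oplus /= [a1 _ + _]addrC. Qed.

Lemma feasible_D'_swap a1 a2 : feasible (a1, a2) -> feasible' (a2, a1).
Proof.
by move=> [f1 f2 f3]; split=> //; rewrite excess_swap; exact: Lp_on2_swap.
Qed.

(** The linear terms trade places, and the penalty is preserved by the change of variables;
    feasibility provides the measurability it requires. *)
Lemma Phi_swap a1 a2 : feasible (a1, a2) ->
  Phi (a1, a2) =
  Defs.Phi la2 la1 Om2 Om1 gamma (c \o swap_pair) mu2 mu1 (a2, a1).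
Proof.
move=> /feasible_measurable[_ _ me]; rewrite /Defs.Phi !Lp_norm_on2E.
rewrite excess_swap integral_swap//; first by rewrite addeAC.
  by apply/measurable_EFinP; exact: measurable_funX.
by move=> z _; rewrite lee_fin sqr_ge0.
Qed.

End swap_problem.

Lemma measure_setX_lty : (la1 Om1 < +oo)%E -> (la2 Om2 < +oo)%E ->
  (la Om < +oo)%E.
Proof.
move=> O1 O2; rewrite product_measure1E// lte_mul_pinfty//.
by rewrite ge0_fin_numE.
Qed.

(** Over a set [A2] of positive measure where [alpha.2 >= - r], the positive part of [alpha.1], read
    as a function of two variables, is dominated by the square-integrable [e + |c| + |r|], with [e]
    the excess; [Lp_on2_fst_inv] then removes the second variable. *)
Lemma feasible_D'_pos_part alpha :
  (la1 Om1 < +oo)%E -> (la2 Om2 < +oo)%E -> (0 < la2 Om2)%E ->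
  Lp_on la 2%:E Om c -> feasible alpha -> Lp_on la1 2%:E Om1 (alpha.1)^\+.
Proof.
move=> O1 O2 O20 cL fa; have [ma1 ma2 me] := feasible_measurable fa.
have [_ _ eL] := fa.
have [r] := exists_superlevel_gt0 mOm2 ma2 O20.
set A2 := _ `&` _ => A20.
have mA2 : measurable A2 by exact: measurable_superlevel.
have A2O : A2 `<=` Om2 by exact: subIsetl.
have mA : measurable (Om1 `*` A2) by exact: measurableX.
have AO : Om1 `*` A2 `<=` Om by move=> z [? /A2O].
have mp : measurable_fun Om1 (alpha.1)^\+ by exact: measurable_maxr.
apply: (Lp_on2_fst_inv mOm1 mA2 A20) => //.
apply: (@le_Lp_on2 _ _ _ _ _ mA _
   (fun z => excess c alpha z + (`|c z| + `|r|))) => //.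
- exact: measurable_fun_fst.
- apply: aeW => z [z1 [z2 /= rz]].
  rewrite ger0_norm ?funrpos_ge0// (le_trans _ (ler_norm _))//.
  have := excess_ge alpha z; have := excess_ge0 alpha z.
  have := ler_norm (c z); have := ler_norm r; have := normr_ge0 r.
  have := normr_ge0 (c z); rewrite /funrpos /= /Num.max; case: ifPn; lra.
- apply: (Lp_on2_subset mOm mA AO).
  apply: Lp_on2D => //; apply: Lp_on2D => //; first exact: Lp_on2_norm.
  exact/Lp_on2_cst/measure_setX_lty.
Qed.

(** This passage to real numbers lets minimality be used as an inequality in an ordered field. *)
Lemma Phi_fin alpha : feasible alpha ->
  la1.-integrable Om1 (fun x => (alpha.1 x * mu1 x)%:E) ->
  la2.-integrable Om2 (fun x => (alpha.2 x * mu2 x)%:E) ->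
  Phi alpha = (2^-1 * (\int[la]_(z in Om) (excess c alpha z ^+ 2))
    - gamma * (\int[la1]_(x in Om1) (alpha.1 x * mu1 x))
    - gamma * (\int[la2]_(x in Om2) (alpha.2 x * mu2 x)))%:E.
Proof.
move=> [_ _ /(Lp_on2P _ mOm)[_ ie]] i1 i2.
rewrite /Defs.Phi Lp_norm_on2E !EFinB !EFinM /Rintegral.
by rewrite !fineK// integrable_fin_num.
Qed.

End dual_problem_theory.

Lemma solves_D'_swap {R : realType} {d1 d2 : measure_display}
    {T1 : measurableType d1} {T2 : measurableType d2}
    (la1 : {sigma_finite_measure set T1 -> \bar R})
    (la2 : {sigma_finite_measure set T2 -> \bar R})
    (Om1 : set T1) (Om2 : set T2)
    (gamma : R) (c : T1 * T2 -> R) (mu1 : T1 -> R) (mu2 : T2 -> R) a1 a2 :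
  measurable Om1 -> measurable Om2 ->
  solves_D' la1 la2 Om1 Om2 gamma c mu1 mu2 (a1, a2) ->
  solves_D' la2 la1 Om2 Om1 gamma (c \o swap_pair) mu2 mu1 (a2, a1).
Proof.
move=> mOm1 mOm2 [fa amin]; split; first exact: feasible_D'_swap.
(* Swapping twice is the identity, so every competitor in the swapped problem comes from one in the
   original problem. *)
move=> [b2 b1] fb; have cE : (c \o swap_pair) \o swap_pair = c.
  by apply/funext => -[].
have {}fb : feasible_D' la1 la2 Om1 Om2 c (b1, b2).
  by rewrite -cE; exact: feasible_D'_swap fb.
by rewrite -!Phi_swap//; exact: amin.
Qed.

(** No summand is [-oo], so a single [y1] or [y2] equal to [-oo] would push the whole sum to
    [+oo]. *)
Lemma penalty_lty_gtNy (R : realType) (g : R) (x y1 y2 : \bar R) :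
  0 < g -> (0 <= x)%E -> (y1 < +oo)%E -> (y2 < +oo)%E ->
  (x - g%:E * y1 - g%:E * y2 < +oo)%E -> (-oo < y1)%E /\ (-oo < y2)%E.
Proof.
move=> g0; case: x => [x _| _|//]; case: y1 => [y1 _|//|_]; case: y2 => [y2 _|//|_];
  by rewrite ?gt0_muleNy ?lte_fin//= ?ltNyr.
Qed.

(** As [g >= 0] almost everywhere, the positive part of [f g] is [f^\+ g], a product of two
    square-integrable functions. *)
Lemma integrable_pos_part_mul d (T : measurableType d) (R : realType)
    (m : {measure set T -> \bar R}) (D : set T) (f g : T -> R) :
  measurable D -> measurable_fun D f -> Lp_on m 2%:E D f^\+ ->
  Lp_on m 2%:E D g -> {ae m, forall x, D x -> 0 <= g x} ->
  m.-integrable D (fun x => (Num.max (f x * g x) 0)%:E).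
Proof.
move=> mD mf fL gL g0; have /integrableP[mfg fgoo] := Lp_on2_mul mD fL gL.
have /(Lp_on2P _ mD)[mg _] := gL.
have mfgp : measurable_fun D (fun x => (Num.max (f x * g x) 0)%:E).
  by apply/measurable_EFinP/measurable_maxr => //; exact: measurable_funM.
apply/integrableP; split=> //.
apply: le_lt_trans fgoo; apply: ae_ge0_le_integral => //.
- exact: measurableT_comp.
- exact: measurableT_comp.
- apply: filterS g0 => x g0 Dx; rewrite lee_fin; have := g0 Dx => gx.
  by rewrite /funrpos maxr_pMl// mul0r.
Qed.

(** * Optimality conditions at a solution of the auxiliary problem *)

Section optimality.
Context {R : realType} {d1 d2 : measure_display}.
Context {T1 : measurableType d1} {T2 : measurableType d2}.
Variable la1 : {sigma_finite_measure set T1 -> \bar R}.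
Variable la2 : {sigma_finite_measure set T2 -> \bar R}.
Variables (Om1 : set T1) (Om2 : set T2).
Hypothesis mOm1 : measurable Om1.
Hypothesis mOm2 : measurable Om2.
Hypotheses (O1 : (la1 Om1 < +oo)%E) (O2 : (la2 Om2 < +oo)%E).
Hypotheses (O10 : (0 < la1 Om1)%E) (O20 : (0 < la2 Om2)%E).
Variables (gamma : R) (c : T1 * T2 -> R) (mu1 : T1 -> R) (mu2 : T2 -> R).
Variables (a1 : T1 -> R) (a2 : T2 -> R).

Local Notation la := (la1 \x la2)%E.
Local Notation Om := (Om1 `*` Om2).
Local Notation feasible := (feasible_D' la1 la2 Om1 Om2 c).
Local Notation Phi := (Phi la1 la2 Om1 Om2 gamma c mu1 mu2).
Local Notation e := (excess c (a1, a2)).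

Hypothesis gamma_gt0 : 0 < gamma.
Hypothesis cL : Lp_on la 2%:E Om c.
Hypothesis mu1L : Lp_on la1 2%:E Om1 mu1.
Hypothesis mu2L : Lp_on la2 2%:E Om2 mu2.
Hypothesis mu1_ge0 : {ae la1, forall x, Om1 x -> 0 <= mu1 x}.
Hypothesis mu2_ge0 : {ae la2, forall x, Om2 x -> 0 <= mu2 x}.
Hypothesis a_min : solves_D' la1 la2 Om1 Om2 gamma c mu1 mu2 (a1, a2).

Let mOm : measurable Om. Proof. exact: measurableX. Qed.
Let laOm : (la Om < +oo)%E. Proof. exact: measure_setX_lty. Qed.
Let mmu1 : measurable_fun Om1 mu1. Proof. by have /(Lp_on2P _ mOm1)[] := mu1L. Qed.
Let mmu2 : measurable_fun Om2 mu2. Proof. by have /(Lp_on2P _ mOm2)[] := mu2L. Qed.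
Let mc : measurable_fun Om c. Proof. by have /(Lp_on2P _ mOm)[] := cL. Qed.

Lemma feasible_D'_0 : feasible (cst 0, cst 0).
Proof.
split.
- by apply/(Lp_on1P _ mOm1); exact: integrable0.
- by apply/(Lp_on1P _ mOm2); exact: integrable0.
apply: (@le_Lp_on2 _ _ _ _ _ mOm _ c) => //.
  by apply: measurable_excess => //=; exact: measurable_cst.
apply: aeW => z _; rewrite ger0_norm ?excess_ge0//.
by rewrite (le_trans (excess_le _ _ _))// /= normr0 !add0r.
Qed.

Lemma Phi0_lty : (Phi (cst 0%R, cst 0%R) < +oo)%E.
Proof.
rewrite Phi_fin ?ltry//; first exact: feasible_D'_0.
  by under eq_fun do rewrite /= mul0r; exact: integrable0.
by under eq_fun do rewrite /= mul0r; exact: integrable0.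
Qed.

(** Comparison with the zero pair gives [Phi (a1, a2) < +oo]. The positive parts are already under
    control, so neither linear integral can be [-oo]. *)
Lemma integrable_a_mu :
  la1.-integrable Om1 (fun x => (a1 x * mu1 x)%:E) /\
  la2.-integrable Om2 (fun x => (a2 x * mu2 x)%:E).
Proof.
have [fa amin] := a_min; have [ma1 ma2 me] := feasible_measurable mOm1 mOm2 fa.
have p1 : Lp_on la1 2%:E Om1 a1^\+ by exact: feasible_D'_pos_part fa.
have p2 : Lp_on la2 2%:E Om2 a2^\+.
  apply: (feasible_D'_pos_part mOm2 mOm1 O2 O1 O10 _ (feasible_D'_swap mOm1 mOm2 fa)).
  exact: Lp_on2_swap.
have i1 := integrable_pos_part_mul mOm1 ma1 p1 mu1L mu1_ge0.
have i2 := integrable_pos_part_mul mOm2 ma2 p2 mu2L mu2_ge0.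
have I1 := integral_lty_of_pos_part mOm1 i1.
have I2 := integral_lty_of_pos_part mOm2 i2.
have Noo : (Phi (a1, a2) < +oo)%E.
  by apply: le_lt_trans Phi0_lty; apply: amin; exact: feasible_D'_0.
have e0 : (0 <= 2^-1%:E * Lp_norm_on la 2%:E Om e ^+ 2)%E.
  rewrite mule_ge0 ?lee_fin ?invr_ge0// Lp_norm_on2E integral_ge0// => z _.
  by rewrite lee_fin sqr_ge0.
have [N1 N2] := penalty_lty_gtNy gamma_gt0 e0 I1 I2 Noo.
split.
  by apply: (integrable_of_integral_gtNy mOm1 _ i1 N1); exact: measurable_funM.
by apply: (integrable_of_integral_gtNy mOm2 _ i2 N2); exact: measurable_funM.
Qed.

(** Keeping [A] arbitrary lets the identity serve twice: in [marginal1] for all [A], and in [a1_ge]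
    for a sublevel set of [a1]. *)
Lemma first_variation (A : set T1) : measurable A -> A `<=` Om1 ->
  (\int[la]_(z in A `*` Om2) (e z)%:E =
   gamma%:E * \int[la1]_(x in A) (mu1 x)%:E)%E.
Proof.
move=> mA AO.
have [fa amin] := a_min; have [ma1 ma2 me] := feasible_measurable mOm1 mOm2 fa.
have [iam1 iam2] := integrable_a_mu.
have [ia1 ia2 eL] := fa; have /(Lp_on1P _ mOm1) {}ia1 := ia1.
have mh t : measurable_fun Om1 (fun x => t * \1_A x : R).
  by apply: measurable_funM => //; exact: measurable_indic.
have hL t : Lp_on la1 2%:E Om1 (fun x => t * \1_A x : R).
  apply: (@Lp_on2_bounded _ _ _ _ _ mOm1 _ `|t|) => //.
  apply: aeW => x _; rewrite normrM ler_piMr// indicE.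
  by case: (x \in A); rewrite ?normr1 ?normr0.
(* The competitor; [t] may have either sign. *)
pose b t : (T1 -> R) * (T2 -> R) := (fun x => a1 x + t * \1_A x, a2).
have fb t : feasible (b t).
  split=> //.
    apply/(Lp_on1P _ mOm1).
    have -> : EFin \o (b t).1 = ((EFin \o a1) \+ (EFin \o (fun x => t * \1_A x)%R))%E.
      by apply/funext => x.
    by apply: integrableD => //; exact: Lp_on2_integrable.
  apply: (@le_Lp_on2 _ _ _ _ _ mOm _ (fun z => e z + `|t * \1_A z.1|)) => //.
  - by apply: measurable_excess => //=; exact: measurable_funD.
  - apply: aeW => z _; rewrite (ger0_norm (excess_ge0 _ _ _)).
    rewrite (le_trans _ (ler_norm _))//.
    exact: (@excess_shift_le _ _ _ _ _ c (a1, a2) (fun x => t * \1_A x)).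
  - apply: Lp_on2D => //; apply: Lp_on2_norm => //.
    exact: (@Lp_on2_fst _ _ _ _ _ la1 la2 Om1 Om2 (fun x => t * \1_A x)).
have indL : Lp_on la1 2%:E Om1 (\1_A : T1 -> R).
  by have := hL 1; under eq_fun do rewrite mul1r.
have indfL : Lp_on la 2%:E Om (fun z => \1_A z.1 : R).
  exact: (@Lp_on2_fst _ _ _ _ _ la1 la2 Om1 Om2 (\1_A : T1 -> R)).
have i_e2 : la.-integrable Om (fun z => (e z ^+ 2)%:E).
  by have /(Lp_on2P _ mOm)[] := eL.
have i_he : la.-integrable Om (fun z => (\1_A z.1 * e z)%:E) by exact: Lp_on2_mul.
have i_h : la.-integrable Om (fun z => (\1_A z.1)%:E : \bar R).
  exact: (@Lp_on2_integrable _ _ _ _ _ mOm (fun z => \1_A z.1)).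
have i_hmu : la1.-integrable Om1 (fun x => (\1_A x * mu1 x)%:E) by exact: Lp_on2_mul.
pose E := \int[la]_(z in Om) (e z ^+ 2).
pose H := \int[la]_(z in Om) (\1_A z.1 * e z).
pose K : R := \int[la]_(z in Om) (\1_A z.1).
pose M := \int[la1]_(x in Om1) (\1_A x * mu1 x).
have K0 : 0 <= K / 2.
  by rewrite divr_ge0// Rintegral_ge0.
(* Minimality against [b t], after cancelling the common terms, reads [0 <= t * (H - gamma * M) + t
   ^+ 2 * (K / 2)] for every real [t]. *)
have HM : H - gamma * M = 0.
  apply: (linear_coef_eq0 K0) => t.
  have i_th : la1.-integrable Om1 (fun x => (t * (\1_A x * mu1 x))%:E).
    by under eq_fun do rewrite EFinM; exact: integrableZl.
  have := amin _ (fb t).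
  rewrite !Phi_fin//; last first.
    rewrite /b /=; under eq_fun do rewrite mulrDl -mulrA EFinD.
    exact: integrableD.
  rewrite lee_fin /b /= -/E.
  have -> : \int[la1]_(x in Om1) ((a1 x + t * \1_A x) * mu1 x) =
      \int[la1]_(x in Om1) (a1 x * mu1 x) + t * M.
    under eq_Rintegral do rewrite mulrDl -mulrA.
    by rewrite RintegralD// RintegralZl.
  have i_2the : la.-integrable Om (fun z => (2 * t * (\1_A z.1 * e z))%:E).
    by under eq_fun do rewrite EFinM; exact: integrableZl.
  have i_t2h : la.-integrable Om (fun z => (t ^+ 2 * \1_A z.1)%:E).
    by under eq_fun do rewrite EFinM; exact: integrableZl.
  have i_s : la.-integrable Om (fun z => (e z ^+ 2 + 2 * t * (\1_A z.1 * e z))%:E).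
    by under eq_fun do rewrite EFinD; exact: integrableD.
  have i_rhs : la.-integrable Om
      (fun z => (e z ^+ 2 + 2 * t * (\1_A z.1 * e z) + t ^+ 2 * \1_A z.1)%:E).
    by under eq_fun do rewrite EFinD; exact: integrableD.
  (* Integrate [excess_shift_sqr]; an indicator is its own square, so the remainder is
     [t ^+ 2 * K]. *)
  have : \int[la]_(z in Om) (excess c (b t) z ^+ 2) <= E + 2 * t * H + t ^+ 2 * K.
    rewrite -!RintegralZl// -!RintegralD//.
    apply: le_Rintegral => //.
    - by have [_ _ /(Lp_on2P _ mOm)[]] := fb t.
    - move=> z _; have := @excess_shift_sqr _ _ _ _ _ c (a1, a2) (fun x => t * \1_A x) z.
      move/le_trans; apply; rewrite /= indicE le_eqVlt; apply/orP; left.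
      by apply/eqP; case: (z.1 \in A) => /=; ring.
  rewrite /b /= => ?; nra.
(* It remains to identify [H] and [M], integrals against indicators, with the integrals over [A] in
   the claim; all of them are finite. *)
have e_ind : (e \_ (A `*` setT)) = fun z => \1_A z.1 * e z.
  apply/funext => z; rewrite patchE indicE.
  by rewrite in_setX in_setT andbT; case: ifPn; rewrite ?mul1r ?mul0r.
have mu_ind : mu1 \_ A = fun x => \1_A x * mu1 x.
  by apply/funext => x; rewrite patchE indicE; case: ifPn; rewrite ?mul1r ?mul0r.
have i_e : la.-integrable Om (EFin \o e) by exact: Lp_on2_integrable.
have i_mu : la1.-integrable Om1 (EFin \o mu1) by exact: Lp_on2_integrable.
have mAX : measurable (A `*` Om2) by exact: measurableX.
have AXO : A `*` Om2 `<=` Om by move=> z [/AO].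
rewrite -[LHS]fineK; last first.
  by apply: (@integrable_fin_num _ _ _ _ _ mAX (EFin \o e)) => //; exact: integrableS i_e.
rewrite -[in RHS](@fineK _ (integral _ _ _)); last first.
  by apply: (@integrable_fin_num _ _ _ _ _ mA (EFin \o mu1)) => //; exact: integrableS i_mu.
rewrite -EFinM; congr EFin.
rewrite -[LHS]/(\int[la]_(z in A `*` Om2) e z)%R.
rewrite -[X in _ = _ * X]/(\int[la1]_(z in A) mu1 z)%R.
have -> : A `*` Om2 = Om `&` (A `*` setT).
  by apply/seteqP; split=> [z [z1 z2]|z [[? ?] []]//]; split=> //; split => //; exact: AO.
rewrite Rintegral_mkcondr e_ind -/H.
rewrite -{1}(setIidr AO) Rintegral_mkcondr mu_ind -/M.
by apply/eqP; rewrite -subr_eq0 HM.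
Qed.

Lemma marginal1 : {ae la1, forall x1, Om1 x1 ->
  (\int[la2]_(x2 in Om2) (gamma^-1 * e (x1, x2))%:E = (mu1 x1)%:E)%E}.
Proof.
have [_ _ me] := feasible_measurable mOm1 mOm2 a_min.1.
have me' : measurable_fun Om (fun z => (gamma^-1 * e z)%:E).
  by apply/measurable_EFinP; exact: measurable_funM.
have e0 z : Om z -> (0 <= (gamma^-1 * e z)%:E)%E.
  by move=> _; rewrite lee_fin mulr_ge0 ?excess_ge0// invr_ge0 ltW.
have [mg _] := tonelli_setX la1 la2 mOm1 mOm2 me' e0.
(* Two functions with equal integrals over all measurable subsets of [Om1] agree almost everywhere;
   [mu1] supplies the integrability. *)
suff : ae_eq la1 Om1 (EFin \o mu1)
    (fun x => \int[la2]_(y in Om2) (gamma^-1 * e (x, y))%:E)%E.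
  by apply: filterS => x H /H <-.
apply: integral_ae_eq => //; first exact: Lp_on2_integrable.
move=> A AO mA.
have AXO : A `*` Om2 `<=` Om by move=> z [/AO].
have mAX : measurable (A `*` Om2) by exact: measurableX.
have [_ <-] := tonelli_setX la1 la2 mA mOm2 (measurable_funS mOm AXO me')
  (fun z Az => e0 z (AXO z Az)).
under [RHS]eq_integral do rewrite EFinM.
rewrite ge0_integralZl_EFin ?invr_ge0 ?(ltW gamma_gt0)//; last 2 first.
- by move=> z _; rewrite lee_fin excess_ge0.
- by apply/measurable_EFinP; exact: measurable_funS me.
by rewrite first_variation// muleA -EFinM mulVf ?gt_eqF// mul1e.
Qed.

Variables (c_low delta : R).
Hypothesis c_ge : {ae la, forall x, Om x -> c_low <= c x}.
Hypothesis delta_gt0 : 0 < delta.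
Hypothesis mu1_ge : {ae la1, forall x, Om1 x -> delta <= mu1 x}.

Lemma a1_ge : exists r : R, {ae la1, forall x, Om1 x -> - r <= a1 x}.
Proof.
have [ma1 ma2 me] := feasible_measurable mOm1 mOm2 a_min.1.
have i_a2c : la2.-integrable Om2 (EFin \o (fun x => a2 x - c_low)).
  have -> : EFin \o (fun x => a2 x - c_low) = ((EFin \o a2) \- (EFin \o cst c_low))%E.
    by apply/funext => x.
  apply: integrableB => //; first by have [_ /(Lp_on1P _ mOm2)] := a_min.1.
  exact/Lp_on2_integrable/Lp_on2_cst.
have gd0 : 0 < gamma * delta by rewrite mulr_gt0.
(* The threshold [gamma * delta] is the one that contradicts the two bounds [le1] and [le2] below
   unless [A] is null. *)
have [r Gr] := integral_pos_part_shift_lt mOm2 gd0 i_a2c.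
set G := (\int[la2]_(x in Om2) _)%E in Gr.
exists r; pose A := Om1 `&` [set x | r <= - a1 x].
have mA : measurable A.
  apply: (@measurable_superlevel _ _ _ _ mOm1 (fun x => - a1 x)).
  exact: measurableT_comp.
have AO : A `<=` Om1 by exact: subIsetl.
have AXO : A `*` Om2 `<=` Om by move=> z [/AO].
have mAX : measurable (A `*` Om2) by exact: measurableX.
suff A0 : la1 A = 0%E.
  exists A; split=> // x /= /not_implyP[Ox /negP]; rewrite -ltNge => ax.
  by split=> //=; rewrite lerNr ltW.
have G0 : (0 <= G)%E.
  by apply: integral_ge0 => x _; rewrite lee_fin le_max lexx orbT.
have Aoo : la1 A \is a fin_num.
  by rewrite ge0_fin_numE// (le_lt_trans _ O1)// le_measure ?inE.
have le1 : (delta%:E * la1 A <= \int[la1]_(x in A) (mu1 x)%:E)%E.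
  rewrite -(integral_cst _ mA delta%:E).
  (* [mu1] is nonnegative only almost everywhere; the absolute value makes the integrand nonnegative
     pointwise, as the comparison of integrals demands. *)
  have -> : (\int[la1]_(x in A) (mu1 x)%:E = \int[la1]_(x in A) `|mu1 x|%:E)%E.
    apply: ae_eq_integral => //.
    - by apply/measurable_EFinP; exact: measurable_funS mmu1.
    - apply/measurable_EFinP/measurableT_comp => //; exact: measurable_funS mmu1.
    - apply: filterS mu1_ge0 => x m0 /AO/m0 m0'; by rewrite ger0_norm.
  apply: ae_ge0_le_integral => //.
  - by move=> x _; rewrite lee_fin ltW.
  - apply/measurable_EFinP/measurableT_comp => //; exact: measurable_funS mmu1.
  - apply: filterS mu1_ge => x md /AO/md dm.
    by rewrite lee_fin (le_trans dm)// ler_norm.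
have mr : measurable_fun Om2 (fun x => Num.max (a2 x - c_low - r) 0).
  by apply: measurable_maxr => //; do 2 apply: measurable_funB => //.
have mr' : measurable_fun (A `*` Om2) (fun z => (Num.max (a2 z.2 - c_low - r) 0)%:E).
  by apply/measurable_EFinP; exact: (measurable_fun_snd mA mOm2 mr).
(* On [A] one has [a1 <= - r], and [c >= c_low] almost everywhere, so [e] is at most a function of
   the second variable alone, with integral [G] over [Om2]. *)
have le2 : (\int[la]_(z in A `*` Om2) (e z)%:E <= G * la1 A)%E.
  apply: (@le_trans _ _
      (\int[la]_(z in A `*` Om2) (Num.max (a2 z.2 - c_low - r) 0)%:E)%E).
    apply: ae_ge0_le_integral => //.
    - by move=> z _; rewrite lee_fin excess_ge0.
    - by apply/measurable_EFinP; exact: measurable_funS me.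
    - by move=> z _; rewrite lee_fin le_max lexx orbT.
    - apply: filterS c_ge => z cz Az; have {}cz := cz (AXO _ Az).
      case: Az => -[_ /= az] _.
      rewrite lee_fin /excess /funrpos /oplus /= ge_max !le_max lexx orbT andbT.
      by apply/orP; left; lra.
  have r0 z : (A `*` Om2) z -> (0 <= (Num.max (a2 z.2 - c_low - r) 0)%:E)%E.
    by move=> _; rewrite lee_fin le_max lexx orbT.
  have [_ ->] := tonelli_setX la1 la2 mA mOm2 mr' r0.
  by rewrite /= -/G integral_cst.
apply/eqP; rewrite eq_le measure_ge0 andbT leNgt; apply/negP => A_gt0.
(* Cancelling the finite positive [la1 A] would give [gamma * delta <= G], against the choice of
   [r]. *)
have : ((gamma * delta)%:E * la1 A <= G * la1 A)%E.
  apply: le_trans le2; rewrite first_variation// EFinM -muleA.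
  by rewrite lee_pmul2l.
by rewrite lee_pmul2r// leNgt Gr.
Qed.

Lemma optimality1 : [/\ Lp_on la1 2%:E Om1 a1, Lp_on la1 +oo%E Om1 a1^\- &
  {ae la1, forall x1, Om1 x1 ->
    (\int[la2]_(x2 in Om2) (gamma^-1 * e (x1, x2))%:E = (mu1 x1)%:E)%E}].
Proof.
have [ma1 ma2 me] := feasible_measurable mOm1 mOm2 a_min.1.
have [r ar] := a1_ge; split; last exact: marginal1.
(* The lower bound [- r] controls the negative part, and [feasible_D'_pos_part] the positive
   part. *)
- apply: (@le_Lp_on2 _ _ _ _ _ mOm1 _ (fun x => a1^\+ x + `|r|)) => //.
    apply: filterS ar => x ar /ar {}ar; rewrite (le_trans _ (ler_norm _))//.
    have := ler_norm r; have := normr_ge0 r; rewrite /funrpos ler_norml /Num.max.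
    by case: ifPn => *; apply/andP; split; lra.
  apply: Lp_on2D => //; last exact: Lp_on2_cst.
  exact: (feasible_D'_pos_part mOm1 mOm2 O1 O2 O20 cL a_min.1).
- apply: (@Lp_ony_bounded _ _ _ _ _ mOm1 _ `|r|).
    by apply: measurable_maxr => //; exact: measurableT_comp.
  apply: filterS ar => x ar /ar {}ar; rewrite ger0_norm ?funrneg_ge0//.
  rewrite /funrneg ge_max normr_ge0 andbT (le_trans _ (ler_norm _))//.
  by rewrite lerNl.
Qed.

(** On sets of finite measure [L^2] lies in [L^1], and the excess is dominated by
    [|b1| + |b2| + |c|]. A minimizer for (D') that is feasible for (D) is thus a minimizer for
    (D). *)
Lemma feasible_D_sub : feasible_D la1 la2 Om1 Om2 `<=` feasible.
Proof.
move=> [b1 b2] /= [b1L b2L].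
have /(Lp_on2P _ mOm1)[mb1 _] := b1L; have /(Lp_on2P _ mOm2)[mb2 _] := b2L.
split; [exact/(Lp_on1P _ mOm1)/Lp_on2_integrable|
        exact/(Lp_on1P _ mOm2)/Lp_on2_integrable|].
apply: (@le_Lp_on2 _ _ _ _ _ mOm _ (fun z => `|b1 z.1| + `|b2 z.2| + `|c z|)) => //.
- exact: measurable_excess.
- apply: aeW => z _; rewrite ger0_norm ?excess_ge0//.
  by rewrite (le_trans (excess_le _ _ _))// ler_norm.
- apply: Lp_on2D => //; last exact: Lp_on2_norm.
  apply: Lp_on2D => //; apply: Lp_on2_norm => //.
    exact: (@Lp_on2_fst _ _ _ _ _ la1 la2 Om1 Om2 b1).
  have := @Lp_on2_fst _ _ _ _ _ la2 la1 Om2 Om1 b2 mOm2 mOm1 O1 b2L.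
  exact: (Lp_on2_swap mOm2 mOm1).
Qed.

End optimality.

(** * Compact subsets of Euclidean space are measurable with finite measure *)

Lemma compact_rV_measurable (R : realType) n (A : set 'rV[R]_n) :
  compact A -> measurable A.
Proof.
move=> /(compact_closed (@norm_hausdorff _ _)) clA.
rewrite -[A]setCK; apply: measurableC; rewrite measurable_rVE.
by apply: sub_sigma_algebra; exact: closed_openC.
Qed.

Lemma compact_rV_lty (R : realType) n (A : set 'rV[R]_n) :
  compact A -> (lebesgue_rV n A < +oo)%E.
Proof.
move=> cA; have [M [_ MA]] := compact_bounded cA.
(* [compact_bounded] bounds the norm by every number strictly above [M], hence [M + 1]. The norm is
   the maximum norm, so [A] lies in a cube. *)
pose I : set R := `[- (M + 1), M + 1]%classic.
have mI : measurable I by exact: measurable_itv.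
have {}MA x i : A x -> I (x ord0 i).
  move=> Ax; have M1 : M < M + 1 by rewrite ltrDl.
  have := MA _ M1 x Ax; rewrite /I /= in_itv/= -ler_norml.
  apply: le_trans; rewrite [leRHS]/Num.norm /= mx_normrE.
  by apply/bigmax_geP; right => /=; exists (ord0, i).
apply: (@le_lt_trans _ _
   (lebesgue_rV n [set x : 'rV[R]_n | forall i, I (x ord0 i)])).
  apply: le_measure; rewrite ?inE; last by move=> x Ax i; exact: MA.
    exact: compact_rV_measurable.
  have -> : [set x : 'rV[R]_n | forall i, I (x ord0 i)] =
      \bigcap_(i in [set: 'I_n])
        ((fun x : 'rV[R]_n => x ord0 i) @^-1` I).
    by apply/seteqP; split => x /= Bx i; [move=> _|]; exact: Bx.
  apply: fin_bigcap_measurable => // i _.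
  by rewrite -[X in measurable X]setTI; exact: measurable_coor.
rewrite (@lebesgue_rV_box _ _ (fun=> I))//.
(* Nonnegativity is carried through the induction because the finiteness of a product of extended
   reals relies on it. *)
suff : (0 <= \prod_(i < n) lebesgue_measure I < +oo)%E.
  by case/andP.
elim/big_ind: _ => [|x y /andP[x0 xoo] /andP[y0 yoo]|i _].
- by rewrite lee_fin ler01 ltry.
- by rewrite mule_ge0// lte_mul_pinfty// ge0_fin_numE.
- by rewrite measure_ge0 /I lebesgue_measure_itv/=; case: ifPn => // _; rewrite ltry.
Qed.

Theorem theorem2p10 (R : realType) (d1 d2 : nat)
    (Om1 : set 'rV[R]_d1) (Om2 : set 'rV[R]_d2)
    (gamma c_low delta : R)
    (c : 'rV[R]_d1 * 'rV[R]_d2 -> R)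
    (mu1 : 'rV[R]_d1 -> R) (mu2 : 'rV[R]_d2 -> R)
    (alpha1 : 'rV[R]_d1 -> R) (alpha2 : 'rV[R]_d2 -> R) :
  let la1 := lebesgue_rV d1 in
  let la2 := lebesgue_rV d2 in
  let la := (la1 \x la2)%E in
  let Om := Om1 `*` Om2 in
  compact Om1 -> (0 < la1 Om1)%E ->
  compact Om2 -> (0 < la2 Om2)%E ->
  0 < gamma ->
  Lp_on la 2%:E Om c ->
  {ae la, forall x, Om x -> c_low <= c x} ->
  0 < delta ->
  Lp_on la1 2%:E Om1 mu1 ->
  {ae la1, forall x, Om1 x -> delta <= mu1 x} ->
  (\int[la1]_(x in Om1) (mu1 x)%:E = 1)%E ->
  Lp_on la2 2%:E Om2 mu2 ->
  {ae la2, forall x, Om2 x -> delta <= mu2 x} ->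
  (\int[la2]_(x in Om2) (mu2 x)%:E = 1)%E ->
  solves_D' la1 la2 Om1 Om2 gamma c mu1 mu2 (alpha1, alpha2) ->
  [/\ Lp_on la1 2%:E Om1 alpha1 /\ Lp_on la2 2%:E Om2 alpha2,
      solves_D la1 la2 Om1 Om2 gamma c mu1 mu2 (alpha1, alpha2),
      Lp_on la1 +oo%E Om1 (alpha1^\-) /\ Lp_on la2 +oo%E Om2 (alpha2^\-),
      {ae la1, forall x1, Om1 x1 ->
        (\int[la2]_(x2 in Om2)
          (gamma^-1 * excess c (alpha1, alpha2) (x1, x2))%:E = (mu1 x1)%:E)%E} &
      {ae la2, forall x2, Om2 x2 ->
        (\int[la1]_(x1 in Om1)
          (gamma^-1 * excess c (alpha1, alpha2) (x1, x2))%:E = (mu2 x2)%:E)%E}].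
Proof.
move=> la1 la2 la Om cOm1 O10 cOm2 O20 gamma0 cL c_ge delta0 mu1L mu1_ge _
  mu2L mu2_ge _ a_min.
have mOm1 : measurable Om1 by exact: compact_rV_measurable.
have mOm2 : measurable Om2 by exact: compact_rV_measurable.
have O1 : (la1 Om1 < +oo)%E by exact: compact_rV_lty.
have O2 : (la2 Om2 < +oo)%E by exact: compact_rV_lty.
have mu1_ge0 : {ae la1, forall x, Om1 x -> 0 <= mu1 x}.
  by apply: filterS mu1_ge => x m /m; exact/le_trans/ltW.
have mu2_ge0 : {ae la2, forall x, Om2 x -> 0 <= mu2 x}.
  by apply: filterS mu2_ge => x m /m; exact/le_trans/ltW.
have [a1L a1ny marg1] := optimality1 mOm1 mOm2 O1 O2 O10 O20 gamma0 cL mu1L mu2L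
  mu1_ge0 mu2_ge0 a_min c_ge delta0 mu1_ge.
have c_ge' : {ae (la2 \x la1)%E, forall z, (Om2 `*` Om1) z ->
    c_low <= (c \o swap_pair) z}.
  have := ae_swap c_ge; apply: filterS => z cz [z2 z1]; exact: cz.
(* The second coordinate is the first coordinate of the swapped problem, with cost
   [c \o swap_pair]. *)
have [a2L a2ny marg2] := optimality1 mOm2 mOm1 O2 O1 O20 O10 gamma0
  (Lp_on2_swap mOm1 mOm2 cL) mu2L mu1L mu2_ge0 mu1_ge0
  (solves_D'_swap mOm1 mOm2 a_min) c_ge' delta0 mu2_ge.
split=> //; last first.
  by apply: filterS marg2 => x2 + Ox2 => /(_ Ox2); rewrite excess_swap.
(* Every competitor for (D) is one for (D'), so minimality is inherited. *)
split=> // b /(feasible_D_sub mOm1 mOm2 O1 O2 cL); exact: a_min.2.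
Qed.
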